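(* Let $f\colon\mathbb{R}^2\to\mathbb{R}$. (1) If $f$ has the Baire property, then the intersection of $FC(f)$ with every nonmeager set $B\subset\mathbb{R}^2$ having the Baire property contains a product of two (nonempty) perfect subsets of $\mathbb{R}$. Consequently, $FC(f)$ is residual in $\mathbb{R}^2$. (2) If $f$ is Lebesgue measurable, then the intersection of $FC(f)$ with every measurable set $B\subset\mathbb{R}^2$ of positive measure contains a product of two (nonempty) perfect subsets of $\mathbb{R}$. Consequently, $FC(f)$ has full outer Lebesgue measure.
   Context: Notation: $x_n\searrow x$ means that $(x_n)$ is a strictly decreasing sequence of reals converging to $x$. A function $f\colon\mathbb{R}^2\to\mathbb{R}$ is feebly continuous at $\langle x,y\rangle$ if there exist sequences $x_n\searrow x$ and $y_m\searrow y$ such that $\lim_{n\to\infty}\lim_{m\to\infty}f(x_n,y_m)=f(x,y)$ (the inner limit exists in $\mathbb{R}$ for each $n$, and the outer limit exists). $FC(f)$ denotes the set of all points of $\mathbb{R}^2$ at which $f$ is feebly continuous. A function has the Baire property if preimages of open sets have the Baire property (i.e. are open modulo meager sets). A set is residual if its complement is meager. A set $E\subset\mathbb{R}^2$ has full outer Lebesgue measure if $\mathbb{R}^2\setminus E$ has inner Lebesgue measure zero, i.e. contains no measurable set of positive measure. *)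

(* Defs.v *)
From HB Require Import structures.
From mathcomp Require Import all_boot all_order all_algebra.
From mathcomp Require Import all_classical all_reals all_analysis.

Set Implicit Arguments.
Unset Strict Implicit.
Unset Printing Implicit Defensive.

Import Order.TTheory GRing.Theory Num.Theory.
Import numFieldNormedType.Exports.

Local Open Scope classical_set_scope.
Local Open Scope ring_scope.

Section baire_category.
Context {T : topologicalType}.
Implicit Type A : set T.

Definition nowhere_dense A := interior (closure A) = set0.

Definition meager A :=
  exists2 F : (set T)^nat, (forall n, nowhere_dense (F n)) & A = \bigcup_n F n.

Definition residual A := meager (~` A).

Definition has_baire_property A :=
  exists2 U : set T, open U & meager (A `+` U).

End baire_category.

Definition baire_fun {T U : topologicalType} (f : T -> U) :=
  forall V : set U, open V -> has_baire_property (f @^-1` V).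

Section plane.
Context {R : realType}.

Definition strictly_decreases_to (u : R^nat) (x : R) :=
  decreasing_seq u /\ u @ \oo --> x.

(* The sequence [v] is chosen once, independently of the index of [u]. *)
Definition feebly_continuous_at (f : R * R -> R) (p : R * R) :=
  exists u v : R^nat,
    [/\ strictly_decreases_to u p.1,
        strictly_decreases_to v p.2,
        forall n, cvgn (fun m => f (u n, v m)) &
        limn (fun m => f (u n, v m)) @[n --> \oo] --> f p].

Definition FC (f : R * R -> R) : set (R * R) :=
  [set p | feebly_continuous_at f p].

Definition contains_perfect_product (A : set (R * R)) :=
  exists P Q : set R,
    [/\ perfect_set P, perfect_set Q, P !=set0, Q !=set0 & P `*` Q `<=` A].

Definition borel_lebesgue2 :
    {measure set (measurableTypeR R * measurableTypeR R) -> \bar R} :=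
  (@lebesgue_measure R \x @lebesgue_measure R)%E.

(* [lplane] is R * R with the sigma-algebra of Lebesgue measurable sets, i.e.
   the sets that are Caratheodory measurable for planar Lebesgue outer measure;
   on R * R itself [measurable] only means Borel. *)
Definition lplane : measurableType (borel_lebesgue2^*)%mu.-cara :=
  caratheodory_type (borel_lebesgue2^*)%mu.

Definition lebesgue2 : {measure set lplane -> \bar R} :=
  @completed_measure_extension _ _ _ borel_lebesgue2.

Definition full_outer_measure (E : set lplane) :=
  ~ exists A : set lplane,
      [/\ measurable A, A `<=` ~` E & (0 < lebesgue2 A)%E].

End plane.

Arguments lplane : clear implicits.

(* Main.v *)
Require Import Defs.
From HB Require Import structures.
From mathcomp Require Import all_boot all_order all_algebra.
From mathcomp Require Import all_classical all_reals all_analysis.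
From mathcomp Require Import lra.

(** A function of the plane that is continuous relative to a set K is feebly
    continuous at (x, y) in K as soon as there are sequences u decreasing to x
    and v decreasing to y with all (u n, y) and all (u n, v m) in K: the inner
    limits are the f (u n, y), and these tend to f (x, y)
    ([feebly_continuous_within]).

    In both halves f is continuous relative to a large set: a residual one if
    f has the Baire property ([baire_fun_continuous_residual]), a closed subset
    of B of positive measure if f is Lebesgue measurable ([lplane_lusin]).  It
    is therefore enough to find a product P * Q of perfect sets inside the
    large set and to discard from P and Q the points that are not limits of
    the set from the right.  To make the latter explicit, perfect sets are
    produced together with a strictly lexicographically increasing continuous
    parametrization phi by binary sequences; restricting phi to the sequences
    with zeros at odd places leaves a perfect set each point of which is a
    limit from the right in the range of phi: switch on one far odd digit
    ([doubled_right_limit]).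

    The products are found one factor at a time.  Perfect sets come from one
    fusion argument ([fusion]): a family of finite sets of reals such that
    every member can be enlarged by a new point arbitrarily close to a
    prescribed old one carries a Cantor set all of whose finite approximations
    belong to the family.
    - Category ([residual_cantor_product]).  Let G j be dense open sets.  The
      family is that of the finite sets of points x all of whose sections
      (G j)_x are dense.  Finitely many such sections meet any given rational
      ball in a common small ball, and this persists when the points move
      slightly; so the resulting Cantor set P satisfies P * H j <= G j with H j
      dense open, and the residual intersection of the H j contains Q.
    - Measure ([positive_cantor_product]).  Let K be closed, bounded in the
      second coordinate and of positive measure.  By Tonelli some c > 0 is
      exceeded by the measures of uncountably many sections K_x.  The family is
      that of the finite sets X, within the condensation points of these x, such
      that the intersection of the K_x for x in X has measure more than c.  The
      sections form a separable space for the distance given by the measure of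
      the symmetric difference, so every x is approached by other points whose
      sections differ little from K_x.  The intersection of all K_x for x in P
      then has measure at least c, and this uncountable closed set contains a
      perfect set Q.

    For residuality, the Kuratowski-Ulam theorem supplies, for residually many
    points (x, y) of the residual set C, sequences u and v as above
    ([FC_residual]).  Full outer measure holds because a set of positive measure,
    containing a product of two nonempty sets that lies in FC f, cannot avoid
    FC f. *)

Set Implicit Arguments.
Unset Strict Implicit.
Unset Printing Implicit Defensive.

Import Order.TTheory GRing.Theory Num.Theory.
Import numFieldNormedType.Exports.

Local Open Scope classical_set_scope.
Local Open Scope ring_scope.

(** * Cantor sets parametrized in lexicographic order *)

Definition agree_below (k : nat) (s t : nat -> bool) :=
  forall i, (i < k)%N -> s i = t i.

(** Strict monotonicity for the lexicographic order, stated at the first place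
    where two sequences differ; it makes phi injective and, above all, tells on
    which side of a point its neighbours lie. *)
Definition cantor_embedding (R : realType) (phi : (nat -> bool) -> R) :=
  (forall e : R, 0 < e ->
     exists k, forall s t, agree_below k s t -> `|phi s - phi t| < e) /\
  (forall s t k, agree_below k s t -> s k = false -> t k = true ->
     phi s < phi t).

Lemma nbhs_agree_below (s : cantor_space) k :
  nbhs s [set t : cantor_space | agree_below k s t].
Proof.
elim: k => [|k IHk].
  by apply: filterS filterT => t _ i.
have : nbhs s [set t : cantor_space | t k = s k].
  apply: (@proj_continuous nat (fun=> bool) k s [set b | b = s k]).
  by apply: open_nbhs_nbhs; split => //; exact: discrete_open.
apply: filterS2 IHk => t IH tk i; rewrite ltnS leq_eqVlt => /orP[/eqP->//|].
exact: IH.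
Qed.

Lemma cantor_embedding_continuous (R : realType) (phi : cantor_space -> R) :
  cantor_embedding phi -> continuous phi.
Proof.
move=> [phi_cont _] s; apply/cvgrPdist_lt => e e0.
have [k phik] := phi_cont e e0.
apply: filterS (nbhs_agree_below s k) => t; exact: phik.
Qed.

(** The range is compact as a continuous image of the Cantor space, and flipping
    one far digit of s gives another point of the range close to phi s. *)
Lemma cantor_embedding_perfect (R : realType) (phi : (nat -> bool) -> R) :
  cantor_embedding phi -> perfect_set (range phi).
Proof.
move=> phiE.
have clR : closed (range phi).
  apply: compact_closed; first exact: Rhausdorff.
  apply: (@continuous_compact cantor_space); last exact: cantor_space_compact.
  exact/continuous_subspaceT/cantor_embedding_continuous.
split=> //; apply/seteqP; split => x; first by move/subset_limit_point/(clR x).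
move=> [s _ <-] U /nbhs_ballP[e /= e0 eU].
have [k phik] := phiE.1 _ e0.
(* t is s with the digit k flipped *)
pose t := fun i => if i == k then ~~ s k else s i.
have st : agree_below k s t by move=> i ik; rewrite /t ltn_eqF.
have tk : t k = ~~ s k by rewrite /t eqxx.
exists (phi t); split; last 2 first.
- by exists t.
- by apply: eU; exact: phik.
- case: (boolP (s k)) => sk; rewrite ?sk in tk.
    by rewrite lt_eqF// (phiE.2 t s k)// => i ik; rewrite -st.
  by rewrite gt_eqF// (phiE.2 s t k)//; exact/negbTE.
Qed.

(** * Points that are limits from the right *)

(** The sequence s 0, 0, s 1, 0, s 2, 0, and so on. *)
Definition doubled (s : nat -> bool) (i : nat) := ~~ odd i && s i./2.

Lemma doubled_even s k : doubled s k.*2 = s k.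
Proof. by rewrite /doubled odd_double doubleK. Qed.

Lemma doubled_odd s k : doubled s k.*2.+1 = false.
Proof. by rewrite /doubled /= odd_double. Qed.

Lemma doubled_agree_below k s t :
  agree_below k s t -> agree_below k.*2 (doubled s) (doubled t).
Proof. by move=> st i ik; rewrite /doubled st // ltn_half_double. Qed.

Lemma agree_below_le j k s t :
  (j <= k)%N -> agree_below k s t -> agree_below j s t.
Proof. by move=> jk st i ij; apply: st; exact: leq_trans jk. Qed.

Lemma cantor_embedding_doubled (R : realType) (phi : (nat -> bool) -> R) :
  cantor_embedding phi -> cantor_embedding (phi \o doubled).
Proof.
move=> [phi_cont phi_mono]; split.
  move=> e /phi_cont[k phik]; exists k => s t /doubled_agree_below st.
  by apply: phik; apply: agree_below_le st; rewrite -addnn leq_addr.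
move=> s t k /doubled_agree_below st sk tk.
by apply: (phi_mono _ _ k.*2) => //; rewrite doubled_even.
Qed.

(** Switch on the odd digit of index n.*2.+1, which is zero in [doubled s], and put
    zeros after it: the value goes up by strict monotonicity, by less and less as
    n grows, and tends to phi (doubled s) by continuity. *)
Lemma doubled_right_limit (R : realType) (phi : (nat -> bool) -> R) s :
  cantor_embedding phi -> exists w : nat -> (nat -> bool),
    strictly_decreases_to (phi \o w) (phi (doubled s)).
Proof.
move=> [phi_cont phi_mono].
pose w n i := if (i < n.*2.+1)%N then doubled s i else i == n.*2.+1.
have ws n : agree_below n.*2.+1 (doubled s) (w n) by move=> i ik; rewrite /w ik.
have wT n : w n n.*2.+1 = true by rewrite /w ltnn eqxx.
exists w; split.
  apply/decreasing_seqP => n /=; apply: (phi_mono _ _ n.*2.+1) => //.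
    move=> i ik; rewrite -(ws n) // -ws //.
    by apply: ltn_trans ik _; rewrite doubleS.
  by rewrite -ws ?doubled_odd// doubleS.
apply/cvgrPdist_lt => e /phi_cont[k phik]; exists k => // n /= kn.
apply: phik; apply: agree_below_le (ws n).
by apply: leq_trans kn _; rewrite -addnn -addSn leq_addl.
Qed.

(** * Feeble continuity from relative continuity *)

Lemma cvg_within_seq (R : realType) (f : R * R -> R) (K : set (R * R))
    (p : R * R) (w : nat -> R * R) :
  {within K, continuous f} -> K p -> (forall n, K (w n)) ->
  w @ \oo --> p -> f (w n) @[n --> \oo] --> f p.
Proof.
move=> /subspace_continuousP/(_ p) fK Kp Kw wp.
move=> U /(fK Kp) /wp wU. move: wU; rewrite /nbhs/=; apply: filterS => n; exact.
Qed.

(** The vertical limits are f (u n, y) because (u n, y) is in K, and these tend to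
    f (x, y) along the horizontal line, again within K. *)
Lemma feebly_continuous_within (R : realType) (f : R * R -> R)
    (K : set (R * R)) (u v : R^nat) (p : R * R) :
  {within K, continuous f} -> K p ->
  (forall n, K (u n, p.2)) -> (forall n m, K (u n, v m)) ->
  strictly_decreases_to u p.1 -> strictly_decreases_to v p.2 -> FC f p.
Proof.
case: p => x y /= fK Kp Ku Kuv ux vy; exists u, v.
have inner n : f (u n, v m) @[m --> \oo] --> f (u n, y).
  apply: (cvg_within_seq (w := fun m => (u n, v m)) fK) => //.
  apply: (@cvg_pair _ _ _ _ (nbhs (u n)) (nbhs y)); first exact: cvg_cst.
  exact: vy.2.
split => //; first by move=> n; apply/cvg_ex; exists (f (u n, y)).
under eq_fun do rewrite (cvg_lim (@Rhausdorff R) (inner _)).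
apply: (cvg_within_seq (w := fun n => (u n, y)) fK) => //.
apply: (@cvg_pair _ _ _ _ (nbhs x) (nbhs y)); last exact: cvg_cst.
exact: ux.2.
Qed.

(** The sparse subsequences give the perfect sets, and the full ranges of phi and
    psi give the sequences that witness feeble continuity at their points. *)
Lemma contains_perfect_product_FC (R : realType) (f : R * R -> R)
    (K B : set (R * R)) (phi psi : (nat -> bool) -> R) :
  {within K, continuous f} -> K `<=` B ->
  cantor_embedding phi -> cantor_embedding psi ->
  (forall s t, K (phi s, psi t)) -> contains_perfect_product (FC f `&` B).
Proof.
move=> fK KB phiE psiE Kphi.
exists (range (phi \o doubled)), (range (psi \o doubled)).
split.
- exact/cantor_embedding_perfect/cantor_embedding_doubled.
- exact/cantor_embedding_perfect/cantor_embedding_doubled.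
- by exists (phi (doubled (fun=> false))), (fun=> false).
- by exists (psi (doubled (fun=> false))), (fun=> false).
move=> [_ _] [/= [s _ <-] [t _ <-]]; split; last exact: KB.
have [u us] := doubled_right_limit s phiE.
have [v vt] := doubled_right_limit t psiE.
by apply: (feebly_continuous_within (p := (_, _)) fK _ _ _ us vt) => *; exact: Kphi.
Qed.

(** * The fusion construction *)

Lemma staged_dependent_choice (T : Type) (I : nat -> T -> Prop)
    (N : nat -> T -> T -> Prop) (x0 : T) :
  I 0%N x0 -> (forall n x, I n x -> exists2 y, I n.+1 y & N n x y) ->
  exists f : nat -> T,
    [/\ f 0%N = x0, forall n, I n (f n) & forall n, N n (f n) (f n.+1)].
Proof.
move=> I0 IN.
pose S := {p : nat * T | I p.1 p.2}.
pose Nx (p q : S) := (sval q).1 = (sval p).1.+1 /\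
   N (sval p).1 (sval p).2 (sval q).2.
have step (p : S) : {q : S | Nx p q}.
  apply: cid; case: p => [[n x] /= Ix]; have [y Iy Nxy] := IN _ _ Ix.
  by exists (exist _ (n.+1, y) Iy).
have [f [f0 fS]] := dependent_choice step (exist _ (0%N, x0) I0).
have fn n : (sval (f n)).1 = n by elim: n => [|n IHn]; rewrite ?f0 ?(fS n).1 ?IHn.
exists (fun n => (sval (f n)).2); split; first by rewrite f0.
- by move=> n; have := svalP (f n); rewrite fn.
- by move=> n; have := (fS n).2; rewrite fn.
Qed.

(** A sequence stands for the finite set of its entries. *)
Definition splittable (R : realType) (F : seq R -> Prop) :=
  forall X x (e : R), F X -> x \in X -> 0 < e ->
    exists x', [/\ x' != x, `|x' - x| < e & F (x' :: X)].

(** Splitting the points one after another: those added early are kept, so one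
    list contains the new companion [g x] of every x in L. *)
Lemma splittable_all (R : realType) (F : seq R -> Prop) (X L : seq R) (e : R) :
  splittable F -> F X -> 0 < e -> {subset L <= X} ->
  exists X' (g : R -> R), [/\ F X', {subset X <= X'} &
    forall x, x \in L -> [/\ g x \in X', g x != x & `|g x - x| < e]].
Proof.
move=> splitF FX e0; elim: L => [|x L IHL] LX.
  by exists X, id; split.
have [|X' [g [FX' XX' gL]]] := IHL.
  by move=> y yL; apply: LX; rewrite inE yL orbT.
have [x' [x'x x'e Fx']] := splitF X' x e FX' (XX' _ (LX _ (mem_head _ _))) e0.
exists (x' :: X'), (fun y => if y == x then x' else g y); split => //.
  by move=> y /XX' yX'; rewrite inE yX' orbT.
move=> y; rewrite inE; have [-> _|_ /= /gL[gy gyy gye]] := eqVneq y x.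
  by rewrite mem_head.
by rewrite inE gy orbT.
Qed.

Lemma seq_gap (R : realType) (g : R -> R) (X : seq R) :
  (forall x, x \in X -> g x != x) ->
  exists2 d : R, 0 < d & forall x, x \in X -> d <= `|g x - x|.
Proof.
elim: X => [|x X IHX] gX; first by exists 1.
have [|d d0 dX] := IHX; first by move=> y yX; apply: gX; rewrite inE yX orbT.
exists (Num.min d `|g x - x|).
  by rewrite lt_min d0 normr_gt0 subr_eq0 gX ?mem_head.
move=> y; rewrite inE => /orP[/eqP->|/dX dy]; first by rewrite ge_min lexx orbT.
by rewrite ge_min dy.
Qed.

Lemma exists_natSinv_lt (R : realType) (e : R) :
  0 < e -> exists n : nat, n.+1%:R^-1 < e.
Proof. by move=> /ltr_add_invr[n]; rewrite add0r; exists n. Qed.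

Lemma nested_balls_point (R : realType) (c r : R^nat) :
  (forall k, 0 < r k) -> (forall k, `|c k.+1 - c k| <= r k - r k.+1) ->
  exists x, forall k, `|x - c k| <= r k.
Proof.
move=> r0 cr.
have lo_nd : {homo (fun k => c k - r k) : m n / (m <= n)%N >-> m <= n}.
  apply/nondecreasing_seqP => n; have := cr n.
  by rewrite ler_norml => /andP[] /=; lra.
have hi_ni : {homo (fun k => c k + r k) : m n / (m <= n)%N >-> n <= m}.
  apply/nonincreasing_seqP => n; have := cr n.
  by rewrite ler_norml => /andP[] /=; lra.
have lohi m n : c m - r m <= c n + r n.
  have := lo_nd _ _ (leq_maxl m n); have := hi_ni _ _ (leq_maxr m n).
  by have := r0 (maxn m n); lra.
exists (sup (range (fun k => c k - r k))) => k.
rewrite ler_distl; apply/andP; split.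
  apply: ub_le_sup; last by exists k.
  by exists (c k + r k) => _ [m _ <-].
apply: ge_sup; first by exists (c 0%N - r 0%N), 0%N.
by move=> _ [m _ <-].
Qed.

(** The tree of intervals behind a perfect set.  At stage k there is a finite set
    X k of the family and a radius r k; every x in X k is split into x and a
    companion [g x], the left child being the smaller of the two, and r k.+1 is
    so small that the balls around both children are disjoint and inside the
    ball around x.  A binary sequence selects nested balls, and phi is their
    common point.

    [Req] collects side conditions that hold for X k as soon as r k is small
    enough; this is how infinitely many open conditions are imposed on the range
    of phi, which lies within r k of X k for every k. *)
Lemma fusion (R : realType) (F : seq R -> Prop)
    (Req : nat -> seq R -> R -> Prop) (x0 r0 : R) :
  0 < r0 -> F [:: x0] -> splittable F ->
  (forall k X, F X ->
     exists2 r : R, 0 < r & forall r' : R, 0 < r' <= r -> Req k X r') ->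
  exists phi (X : nat -> seq R) (r : R^nat),
    [/\ cantor_embedding phi, forall s, `|phi s - x0| <= r0,
        forall k, [/\ F (X k), {subset X k <= X k.+1} & Req k (X k) (r k)],
        forall k, 0 < r k < k.+1%:R^-1 &
        forall s k, exists2 x, x \in X k & `|phi s - x| <= r k].
Proof.
move=> r0_gt0 Fx0 splitF reqF.
have inv0 k : 0 < k.+1%:R^-1 :> R by rewrite invr_gt0.
have small k X (d : R) : 0 < d -> F X ->
    exists r : R, [/\ 0 < r, r < d, r < k.+1%:R^-1 & Req k X r].
  move=> d0 /(reqF k)[q q0 Xq].
  exists (Num.min (d / 2) (Num.min (k.+1%:R^-1 / 2) q)); split.
  - by rewrite !lt_min q0 !divr_gt0.
  - by rewrite gt_min; apply/orP; left; lra.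
  - by rewrite !gt_min; apply/orP; right; apply/orP; left;
    rewrite gtr_pMr ?inv0// invf_lt1 ?ltr1n.
  - apply: Xq; rewrite !lt_min q0 !divr_gt0//=.
    by rewrite !ge_min lexx !orbT.
pose St := (seq R * (R -> R) * R)%type.
pose I k (S : St) := [/\ F S.1.1, Req k S.1.1 S.2 & 0 < S.2 < k.+1%:R^-1].
pose N (k : nat) (S S' : St) := {subset S.1.1 <= S'.1.1} /\
  forall x, x \in S.1.1 -> [/\ S'.1.2 x \in S'.1.1,
    `|S'.1.2 x - x| <= S.2 - S'.2 & 2 * S'.2 < `|S'.1.2 x - x|].
have [r [rgt0 rr0 r1 Req0]] := small 0%N _ _ r0_gt0 Fx0.
have [||f [f0 fI fN]] := @staged_dependent_choice St I N ([:: x0], id, r).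
- by split => //=; rewrite rgt0.
- move=> k [[X g] s] [/= FX _ /andP[s0 _]].
  have s2 : 0 < s / 2 by rewrite divr_gt0.
  have [X' [g' [FX' XX' gX]]] := splittable_all splitF FX s2 (fun _ => id).
  have [|d d0 dX] := @seq_gap _ g' X; first by move=> x /gX[].
  have [r' [r'0 r'd r'1 Req']] := small k.+1 X' (Num.min (s / 2) (d / 2))
    ltac:(by rewrite lt_min s2 divr_gt0) FX'.
  exists (X', g', r'); first by split => //=; rewrite r'0.
  split => //= x xX; have [gx _ gxs] := gX _ xX; have dx := dX _ xX.
  by move: r'd; rewrite lt_min => /andP[? ?]; split => //; lra.
pose X k := (f k).1.1; pose g k := (f k.+1).1.2; pose q k := (f k).2.
(* the centre of the ball selected at stage k by the digits of s below k *)
pose c (s : nat -> bool) := fix c k : R := if k is j.+1 then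
  (if s j then Num.max else Num.min) (c j) (g j (c j)) else x0.
have cX s k : c s k \in X k.
  elim: k => [|k IHk] /=; first by rewrite /X f0 mem_head.
  have [gX _ _] := (fN k).2 _ IHk; have cX' := (fN k).1 _ IHk.
  by case: (s k); rewrite ?maxEle ?minEle; case: ifP.
have q0 k : 0 < q k by have [_ _ /andP[]] := fI k.
have cS s k : `|c s k.+1 - c s k| <= q k - q k.+1.
  have [_ gc gq] := (fN k).2 _ (cX s k); rewrite -/(q k) -/(q k.+1) in gc gq.
  apply: le_trans gc => /=; case: (s k); rewrite ?maxEle ?minEle;
    by case: ifP => _; rewrite ?subrr ?normr0.
have /choice[phi phiE] s : exists x, forall k, `|x - c s k| <= q k.
  exact: nested_balls_point (q0) (cS s).
have cE s t k : agree_below k s t -> c s k = c t k.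
  elim: k => // k IHk st /=; rewrite IHk; first by rewrite st.
  by apply: agree_below_le st.
exists phi, X, q; split.
- split.
    move=> e e0.
    have [k qk] : exists k, q k < e / 2.
      have [k ke] := exists_natSinv_lt (divr_gt0 e0 (ltr0n R 2)).
      by exists k; apply: lt_trans ke; have [_ _ /andP[]] := fI k.
    exists k => s t /cE st; have := phiE s k; have := phiE t k.
    rewrite st !ler_distl => /andP[? ?] /andP[? ?].
    by rewrite ltr_distl; apply/andP; split; lra.
  move=> s t k /cE st sk tk.
  have := phiE s k.+1; have := phiE t k.+1.
  have [_ _] := (fN k).2 _ (cX s k); rewrite -/(q k.+1) -/(g k) /= sk tk st.
  move=> gap; rewrite !ler_distl => /andP[? _] /andP[_ ?].
  have : 2 * q k.+1 < Num.max (c t k) (g k (c t k)) - Num.min (c t k) (g k (c t k)).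
    apply: lt_le_trans gap _.
    by have [le|/ltW le] := leP (c t k) (g k (c t k)); [|rewrite distrC];
      rewrite ger0_norm ?subr_ge0.
  lra.
- move=> s; apply: le_trans (phiE s 0%N) _; rewrite /q f0 /=; exact: ltW.
- by move=> k; have [FX Rq _] := fI k; split => //; exact: (fN k).1.
- by move=> k; have [] := fI k.
- by move=> s k; exists (c s k).
Qed.

(** * Residual sets *)

(** Indexed by all natural numbers through pickling; the value at indices that code
    nothing only has to be open and nonempty. *)
Definition rational_ball (R : realType) (n : nat) : set R :=
  if unpickle n is Some (q, m) then ball (ratr q : R) (m.+1%:R^-1)
  else ball (0 : R) 1.

Lemma rational_ball_open (R : realType) n : open (@rational_ball R n).
Proof. by rewrite /rational_ball; case: unpickle => [[q m]|]; exact: ball_open. Qed.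

Lemma rational_ball_neq0 (R : realType) n : @rational_ball R n !=set0.
Proof.
rewrite /rational_ball; case: unpickle => [[q m]|].
  by exists (ratr q); apply: ballxx; rewrite invr_gt0.
by exists 0; exact: ballxx.
Qed.

Lemma rational_ball_basis (R : realType) (x : R) (U : set R) :
  nbhs x U -> exists n, @rational_ball R n x /\ @rational_ball R n `<=` U.
Proof.
move=> /nbhs_ballP[e /= e0 eU].
have [m me] := exists_natSinv_lt (divr_gt0 e0 (ltr0n R 2)).
have m0 : 0 < m.+1%:R^-1 :> R by rewrite invr_gt0.
have [q] := @rat_in_itvoo R (x - m.+1%:R^-1) (x + m.+1%:R^-1)
  ltac:(by rewrite ltrBlDr -addrA ltrDl addr_gt0).
rewrite in_itv /= => /andP[q1 q2].
exists (pickle (q, m)); rewrite /rational_ball pickleK.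
move: (m.+1%:R^-1) me m0 q1 q2 => d de d0 q1 q2; split.
  by rewrite /ball /= ltr_distl; apply/andP; split; lra.
move=> y; rewrite /ball /= ltr_distl => /andP[y1 y2]; apply: eU.
by rewrite /ball /= ltr_distl; apply/andP; split; lra.
Qed.

(** Nowhere dense sets give dense open ones as complements of their closures.
    Conversely, the complements of the dense open sets are cut down to ~` A, since
    a meager set must be exactly a union of nowhere dense sets. *)
Lemma residualP (T : topologicalType) (A : set T) :
  residual A <->
  exists2 G : (set T)^nat, (forall j, open (G j) /\ dense (G j)) &
    \bigcap_j G j `<=` A.
Proof.
split=> [[F F0 AF]|[G G0 GA]].
  exists (fun j => ~` closure (F j)).
    move=> j; split; first exact/closed_openC/closed_closure.
    move=> O [x Ox] oO; apply: contrapT => OF; have := F0 j.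
    apply/eqP/set0P; exists x; rewrite /interior nbhsE; exists O => //.
    by move=> y Oy; apply: contrapT => Fy; apply: OF; exists y.
  move=> x Gx; apply: contrapT; rewrite -[~ A x]/((~` A) x) AF => -[j _ Fjx].
  exact: (Gx j I (subset_closure Fjx)).
exists (fun j => ~` A `&` ~` G j).
  move=> j; apply/seteqP; split => // x.
  rewrite /interior nbhsE; move=> [V [oV Vx] VG].
  have [y [Vy Gy]] := (G0 j).2 V (ex_intro _ x Vx) oV.
  have : closure (~` G j) y.
    by apply: closure_subset (VG _ Vy) => z [].
  by rewrite -(iffLR (closure_id _) (open_closedC (G0 j).1)) => /(_ Gy).
apply/seteqP; split => x; last by case=> j _ [].
move=> Ax; apply: contrapT => nG; apply: (Ax); apply: GA => j _.
by apply: contrapT => Gjx; apply: nG; exists j.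
Qed.

Lemma residual_subset (T : topologicalType) (A B : set T) :
  A `<=` B -> residual A -> residual B.
Proof.
move=> AB /residualP[G G0 GA]; apply/residualP; exists G => //.
exact: subset_trans AB.
Qed.

Lemma residual_bigcap (T : topologicalType) (A : (set T)^nat) :
  (forall n, residual (A n)) -> residual (\bigcap_n A n).
Proof.
move=> Ares.
have /choice[G GA] n : exists G : (set T)^nat,
    (forall j, open (G j) /\ dense (G j)) /\ \bigcap_j G j `<=` A n.
  by have /residualP[G] := Ares n; exists G.
apply/residualP.
exists (fun k => if unpickle k is Some (n, j) then G n j else setT).
  move=> k; case: unpickle => [[n j]|]; first exact: (GA n).1.
  by split; [exact: openT|move=> O [x Ox] _; exists x].
move=> x Gx n _; apply: (GA n).2 => j _.
by have := Gx (pickle (n, j)) I; rewrite pickleK.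
Qed.

Lemma residualI (T : topologicalType) (A B : set T) :
  residual A -> residual B -> residual (A `&` B).
Proof.
move=> Ares Bres; have := @residual_bigcap T (fun n => if n is 0%N then A else B).
move=> /(_ _)/residual_subset; apply; last by case.
by move=> x AB; split; [exact: (AB 0%N)|exact: (AB 1%N)].
Qed.

Lemma residual_dense_open (T : topologicalType) (A : set T) :
  open A -> dense A -> residual A.
Proof. by move=> oA dA; apply/residualP; exists (fun=> A) => // x /(_ 0%N I). Qed.

Lemma residual_dense (R : realType) (A : set R) : residual A -> dense A.
Proof.
move=> /residualP[G G0 GA] O O0 oO.
have [x [Ox Gx]] := @Baire R R^o G G0 O O0 oO.
by exists x; split => //; exact: GA.
Qed.

Lemma dense_strictly_decreases (R : realType) (A : set R) (x : R) :
  dense A -> exists2 u, strictly_decreases_to u x & forall n, A (u n).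
Proof.
move=> dA.
have dAx (e : R) : 0 < e -> exists2 y, A y & x < y < x + e.
  move=> e0; have [|y [xy Ay]] := dA _ _ (itv_open x (x + e)).
    by exists (x + e / 2); rewrite /= in_itv/=; apply/andP; split; lra.
  by exists y => //; move: xy; rewrite /= in_itv.
have inv0 k : 0 < k.+1%:R^-1 :> R by rewrite invr_gt0.
have [y0 Ay0 xy0] := dAx _ (inv0 0%N).
have [||u [_ uI uN]] := @staged_dependent_choice R
  (fun n y => A y /\ x < y < x + n.+1%:R^-1) (fun _ y z => z < y) y0.
- by [].
- move=> n y [Ay /andP[xy yx]].
  have [|z Az /andP[xz zx]] := dAx (Num.min (y - x) n.+2%:R^-1).
    by rewrite lt_min subr_gt0 xy inv0.
  move: zx; rewrite -ltrBlDl lt_min => /andP[z1 z2]; exists z; last by lra.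
  by split => //; rewrite xz -ltrBlDl.
exists u; last by move=> n; have [] := uI n.
split; first exact/decreasing_seqP.
apply/cvgrPdist_lt => e e0; near=> n.
have [_ /andP[xu ux]] := uI n.
rewrite ltr0_norm ?subr_lt0// opprB ltrBlDl (lt_trans ux)// ltrD2l.
by near: n; exact: (near_infty_natSinv_lt (PosNum e0)).
Unshelve. all: by end_near. Qed.

(** * Residual sets in the plane *)

Lemma open_plane_box (R : realType) (G : set (R * R)) (x y : R) :
  open G -> G (x, y) -> exists2 e : R, 0 < e &
    forall a b, `|a - x| < e -> `|b - y| < e -> G (a, b).
Proof.
rewrite openE => /(_ (x, y)) + Gxy => /(_ Gxy); rewrite /interior => /nbhs_ballP.
move=> [e /= e0 eG]; exists e => // a b ax bty; apply: eG.
by split; rewrite /ball /= distrC.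
Qed.

Lemma open_box (R : realType) (A B : set R) : open A -> open B -> open (A `*` B).
Proof.
move=> oA oB.
have -> : A `*` B = fst @^-1` A `&` snd @^-1` B by [].
apply: openI; apply: open_comp => // p _; [exact: cvg_fst|exact: cvg_snd].
Qed.

Lemma open_section1 (R : realType) (G : set (R * R)) (x : R) :
  open G -> open [set y | G (x, y)].
Proof.
move=> oG; rewrite openE => y /= Gxy; apply/nbhs_ballP.
have [e e0 eG] := open_plane_box oG Gxy; exists e => //= z.
by rewrite /ball /= distrC => yz; apply: eG => //; rewrite subrr normr0.
Qed.

Lemma open_section2 (R : realType) (G : set (R * R)) (y : R) :
  open G -> open [set x | G (x, y)].
Proof.
move=> oG; rewrite openE => x /= Gxy; apply/nbhs_ballP.
have [e e0 eG] := open_plane_box oG Gxy; exists e => //= z.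
by rewrite /ball /= distrC => yz; apply: eG => //; rewrite subrr normr0.
Qed.

Lemma residual_preimage_snd (R : realType) (A : set R) :
  residual A -> residual ([set p | A p.2] : set (R * R)).
Proof.
move=> /residualP[G G0 GA]; apply/residualP.
exists (fun j => [set p | G j p.2]); last first.
  by move=> p Gp; apply: GA => j _; exact: (Gp j I).
move=> j; split.
  have -> : [set p : R * R | G j p.2] = setT `*` G j.
    by apply/seteqP; split => p //= [].
  by apply: open_box; [exact: openT|exact: (G0 j).1].
move=> V [[x y] Vxy] oV.
have [|z [Vxz Gz]] := (G0 j).2 _ _ (open_section1 (x := x) oV); first by exists y.
by exists (x, z).
Qed.

(** Density of the section at x means meeting every rational ball, and for one
    such ball this is an open condition on x, which is dense since G meets all
    products of open sets. *)
Lemma residual_dense_section1 (R : realType) (G : set (R * R)) :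
  open G -> dense G -> residual [set x | dense [set y | G (x, y)]].
Proof.
move=> oG dG.
apply: (@residual_subset _
    (\bigcap_n [set x | exists2 y, rational_ball n y & G (x, y)])).
  move=> x Gx V [y Vy] oV.
  have [n [_ nV]] := rational_ball_basis (open_nbhs_nbhs (conj oV Vy)).
  by have [z zn Gz] := Gx n I; exists z; split => //; exact: nV.
apply: residual_bigcap => n; apply: residual_dense_open.
  have -> : [set x | exists2 y, rational_ball n y & G (x, y)] =
      \bigcup_(y in rational_ball n) [set x | G (x, y)].
    by apply/seteqP; split => x [y yn Gy]; exists y.
  by apply: bigcup_open => y _; exact: open_section2.
move=> V [x Vx] oV.
have [y yn] := @rational_ball_neq0 R n.
have [|[a b] [[Va nb] Gab]] := dG (V `*` rational_ball n) _
    (open_box oV (@rational_ball_open R n)); first by exists (x, y).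
by exists a; split => //; exists b.
Qed.

Lemma residual_dense_section2 (R : realType) (G : set (R * R)) :
  open G -> dense G -> residual [set y | dense [set x | G (x, y)]].
Proof.
have swapC : continuous (fun p : R * R => (p.2, p.1)).
  by move=> p; apply: (@cvg_pair _ _ _ _ (nbhs p.2) (nbhs p.1));
    [exact: cvg_snd|exact: cvg_fst].
have oswap (H : set (R * R)) : open H -> open ((fun p => (p.2, p.1)) @^-1` H).
  by move=> oH; apply: open_comp => // p _; exact: swapC.
move=> oG dG; apply: (residual_dense_section1 (oswap _ oG)).
move=> V [[x y] Vxy] oV.
have [|[a b] [Vab Gab]] := dG _ _ (oswap _ oV); first by exists (y, x).
by exists (b, a).
Qed.

(** One direction of the Kuratowski-Ulam theorem. *)
Lemma residual_section1 (R : realType) (A : set (R * R)) :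
  residual A -> residual [set x | residual [set y | A (x, y)]].
Proof.
move=> /residualP[G G0 GA].
apply: (@residual_subset _ (\bigcap_j [set x | dense [set y | G j (x, y)]])).
  move=> x Gx; apply/residualP; exists (fun j => [set y | G j (x, y)]).
    by move=> j; split; [exact: open_section1 (G0 j).1|exact: Gx].
  by move=> y Gy; apply: GA => j _; exact: (Gy j I).
apply: residual_bigcap => j.
exact: residual_dense_section1 (G0 j).1 (G0 j).2.
Qed.

Lemma residual_section2 (R : realType) (A : set (R * R)) :
  residual A -> residual [set y | residual [set x | A (x, y)]].
Proof.
move=> /residualP[G G0 GA].
apply: (@residual_subset _ (\bigcap_j [set y | dense [set x | G j (x, y)]])).
  move=> y Gy; apply/residualP; exists (fun j => [set x | G j (x, y)]).
    by move=> j; split; [exact: open_section2 (G0 j).1|exact: Gy].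
  by move=> x Gx; apply: GA => j _; exact: (Gx j I).
apply: residual_bigcap => j.
exact: residual_dense_section2 (G0 j).1 (G0 j).2.
Qed.

(** Remove for every rational ball the meager difference between its preimage and
    an open set: what remains is residual, and relative to it these preimages are
    open. *)
Lemma baire_fun_continuous_residual (R : realType) (f : R * R -> R) :
  baire_fun f -> exists2 C, residual C & {within C, continuous f}.
Proof.
move=> fB.
have /choice[U UE] n : exists U : set (R * R),
    open U /\ meager (f @^-1` (rational_ball n) `+` U).
  by have [U oU mU] := fB _ (@rational_ball_open R n); exists U.
exists (\bigcap_n ~` (f @^-1` (rational_ball n) `+` U n)).
  by apply: residual_bigcap => n; rewrite /residual setCK; exact: (UE n).2.
apply/subspace_continuousP => p Cp V /rational_ball_basis[n [nfp nV]].
have CE q : (\bigcap_n ~` (f @^-1` (rational_ball n) `+` U n)) q ->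
    rational_ball n (f q) <-> U n q.
  move=> /(_ n I) Cq; split => h; apply: contrapT => h'; apply: Cq.
    by left.
  by right.
rewrite /= /nbhs /= /within /=.
have : nbhs p (U n).
  by apply: open_nbhs_nbhs; split; [exact: (UE n).1|exact/CE].
by apply: filterS => q Uq Cq; apply: nV; apply/CE.
Qed.

(** Let C be the residual set of continuity and take (x, y) in C such that the
    horizontal section of C at y is residual.  Residually many u have both (u, y)
    in C and a residual vertical section; choose u n among them, decreasing to x,
    and then v m decreasing to y in the intersection of the countably many
    sections at the u n. *)
Lemma FC_residual (R : realType) (f : R * R -> R) (C : set (R * R)) :
  residual C -> {within C, continuous f} -> residual (FC f).
Proof.
move=> Cres fC.
apply: (@residual_subset _
    (C `&` [set p | residual [set x | C (x, p.2)]])); last first.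
  apply: residualI => //.
  exact: (residual_preimage_snd (residual_section2 Cres)).
move=> [x y] /= [Cxy Cy].
have [u ux Cu] := dense_strictly_decreases x
  (residual_dense (residualI Cy (residual_section1 Cres))).
have Cuv : residual (\bigcap_n [set z | C (u n, z)]).
  by apply: residual_bigcap => n; exact: (Cu n).2.
have [v vy Cv] := dense_strictly_decreases y (residual_dense Cuv).
apply: (feebly_continuous_within (p := (x, y)) fC _ _ _ ux vy) => //=.
- by move=> n; exact: (Cu n).1.
- by move=> n m; exact: (Cv m n I).
Qed.

(** * Products of Cantor sets in residual sets *)

Lemma splittable_dense (R : realType) (A : set R) :
  dense A -> splittable (fun X : seq R => forall x, x \in X -> A x).
Proof.
move=> dA X x e AX xX e0.
have [|z [xz Az]] := dA _ _ (itv_open x (x + e)).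
  by exists (x + e / 2); rewrite /= in_itv/=; apply/andP; split; lra.
move: xz; rewrite /= in_itv/= => /andP[xz ze]; exists z; split.
- by rewrite gt_eqF.
- by rewrite gtr0_norm ?subr_gt0// ltrBlDl.
- by move=> w; rewrite inE => /orP[/eqP->|/AX].
Qed.

(** Density of the section at x yields a point (x, y) of G with y in the current
    set V, hence a small box around it in G; the points of X are treated in turn,
    shrinking V and the radius. *)
Lemma common_box (R : realType) (G : set (R * R)) (X : seq R) (V : set R) :
  open G -> (forall x, x \in X -> dense [set y | G (x, y)]) ->
  open V -> V !=set0 ->
  exists (W : set R) (r : R), [/\ open W, W !=set0, W `<=` V, 0 < r &
    forall x a y, x \in X -> `|a - x| <= r -> W y -> G (a, y)].
Proof.
move=> oG; elim: X => [|x X IHX] dX oV V0.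
  by exists V, 1; split.
have [|W [r [oW W0 WV r0 WG]]] := IHX _ oV V0.
  by move=> z zX; apply: dX; rewrite inE zX orbT.
have [y [Wy Gxy]] := dX x (mem_head _ _) W W0 oW.
have [e e0 eG] := open_plane_box oG Gxy.
exists (W `&` ball y e), (Num.min r (e / 2)); split.
- by apply: openI => //; exact: ball_open.
- by exists y; split => //; exact: ballxx.
- by move=> z [/WV].
- by rewrite lt_min r0 divr_gt0.
move=> z a w; rewrite inE le_min => /orP[/eqP->|zX] /andP[ar ae] [Ww yw].
  apply: eG; last by move: yw; rewrite /ball /= distrC.
  lra.
exact: WG zX ar Ww.
Qed.

(** First P, then Q.  The requirement of stage k for P, where k codes (j, n), is
    a box condition: some open part W of the n-th rational ball satisfies
    [a - r, a + r] * W <= G j around all current points a.  The union over n of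
    these W is a dense open set of ordinates y such that P * {y} lies in G j.
    The range of psi is then placed inside the residual intersection of these sets
    over j. *)
Lemma residual_cantor_product (R : realType) (A U : set (R * R)) :
  residual A -> open U -> U !=set0 ->
  exists phi psi : (nat -> bool) -> R,
    [/\ cantor_embedding phi, cantor_embedding psi &
        forall s t, U (phi s, psi t) /\ A (phi s, psi t)].
Proof.
move=> /residualP[G G0 GA] oU [[x0 y0] Uxy].
have [e e0 eU] := open_plane_box oU Uxy.
have e2 : 0 < e / 2 by rewrite divr_gt0.
pose X0 := \bigcap_j [set x | dense [set y | G j (x, y)]].
have dX0 : dense X0.
  apply/residual_dense/residual_bigcap => j.
  exact: residual_dense_section1 (G0 j).1 (G0 j).2.
have [|x [x0x X0x]] := dX0 (ball x0 (e / 2)) _ (@ball_open _ _ _ _).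
  by exists x0; exact: ballxx.
pose Req (k : nat) (X : seq R) (r : R) := if unpickle k is Some (j, n) then
  exists W : set R, [/\ open W, W !=set0, W `<=` rational_ball n &
    forall x a y, x \in X -> `|a - x| <= r -> W y -> G j (a, y)] else True.
have [||phi [X [r [phiE phix XE _ phiX]]]] :=
    fusion (Req := Req) (x0 := x) e2 _ (splittable_dense dX0).
- by move=> z; rewrite inE => /eqP->.
- move=> k X XX0; rewrite /Req; case: unpickle => [[j n]|]; last by exists 1.
  have [|W [r [oW W0 Wn r0 WG]]] := common_box (G0 j).1 _
      (@rational_ball_open R n) (@rational_ball_neq0 R n) (X := X).
    by move=> z /XX0; exact.
  exists r => // r' /andP[_ r'r]; exists W; split => // z a y zX az.
  by apply: WG zX _; exact: le_trans r'r.
(* the interior of the set of y such that range phi * {y} lies in G j *)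
pose H (j : nat) := [set y : R | nbhs y [set z | forall s, G j (phi s, z)]].
have oH j : open (H j) by exact: open_interior.
have dH j : dense (H j).
  move=> V [y Vy] oV.
  have [n [_ nV]] := rational_ball_basis (open_nbhs_nbhs (conj oV Vy)).
  have [_ _] := XE (pickle (j, n)); rewrite /Req pickleK.
  move=> [W [oW [z Wz] Wn WG]]; exists z; split; first by apply: nV; exact: Wn.
  rewrite /H /= nbhsE; exists W => // w Ww s.
  by have [a aX phia] := phiX s (pickle (j, n)); exact: WG aX phia Ww.
have dH' : dense (\bigcap_j H j).
  by apply/residual_dense/residual_bigcap => j; exact: residual_dense_open.
have [|y [y0y Hy]] := dH' (ball y0 (e / 2)) _ (@ball_open _ _ _ _).
  by exists y0; exact: ballxx.
pose Req' (k : nat) (X : seq R) (r : R) :=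
  forall x a : R, x \in X -> `|a - x| <= r -> H k a.
have [||psi [Y [r' [psiE psiy YE _ psiY]]]] :=
    fusion (Req := Req') (x0 := y) e2 _ (splittable_dense dH').
- by move=> z; rewrite inE => /eqP->.
- move=> k; elim=> [|z Z IHZ] ZH; first by exists 1.
  have [|q q0 qZ] := IHZ; first by move=> w wZ; apply: ZH; rewrite inE wZ orbT.
  have := oH k; rewrite openE => /(_ z (ZH z (mem_head _ _) k I)).
  move=> /nbhs_ballP[d /= d0 dz].
  exists (Num.min q (d / 2)); first by rewrite lt_min q0 divr_gt0.
  move=> p; rewrite le_min => /andP[p0 /andP[pq pd]] w a; rewrite inE.
  move=> /orP[/eqP-> az|wZ aw].
    by apply: dz; rewrite /ball /= distrC; lra.
  by apply: (qZ q _ w) => //; [rewrite q0 lexx|exact: le_trans pq].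
exists phi, psi; split => // s t; split.
  have := phix s; have := psiy t; move: x0x y0y; rewrite /ball /= !ltr_norml.
  rewrite !ler_norml => /andP[? ?] /andP[? ?] /andP[? ?] /andP[? ?].
  by apply: eU; rewrite ltr_norml; apply/andP; split; lra.
apply: GA => j _; have [z zY psiz] := psiY t j.
have [_ _ /(_ z _ zY psiz)/nbhs_singleton] := YE j.
exact.
Qed.

(** * Condensation points *)

(** Think of each [c n] as a partition of U into countably many small pieces.
    Discarding from E the points that lie, for some n, in a piece meeting E in a
    countable set removes only countably many points; each piece of a remaining
    point still contains uncountably many of the remaining points. *)
Lemma uncountable_condensation (U : Type) (T : countType) (c : nat -> U -> T)
    (E : set U) : ~ countable E ->
  exists2 E' : set U, E' `<=` E /\ E' !=set0 &
    forall x n, E' x -> exists x', [/\ x' <> x, E' x' & c n x' = c n x].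
Proof.
move=> uE.
pose fibre n (t : T) := E `&` [set x | c n x = t].
pose bad := \bigcup_n \bigcup_(t in [set t | countable (fibre n t)]) fibre n t.
have cbad : countable bad.
  apply: bigcup_countable => // n _; apply: bigcup_countable => [|t //].
  exact: countableP.
pose E' := E `\` bad.
have uE' (A : set U) : ~ countable A -> ~ countable (A `\` bad).
  move=> uA cA; apply: uA.
  apply: (@sub_countable _ _ _ ((A `\` bad) `|` bad)).
    apply: subset_card_le => x Ax; have [bx|bx] := pselect (bad x); [by right|].
    by left.
  rewrite -bigcup2E; apply: bigcup_countable => // -[|[|n]] _ /=.
  - exact: cA.
  - exact: cbad.
  - exact: countable0.
have not_sub (A B : set U) : ~ countable A -> countable B ->
    exists x, A x /\ ~ B x.
  move=> uA cB; apply: contrapT => AB; apply: uA.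
  apply: sub_countable cB; apply: subset_card_le => x Ax; apply: contrapT => Bx.
  by apply: AB; exists x.
exists E'.
  split; first by move=> x [].
  by have [x [E'x _]] := not_sub _ _ (uE' _ uE) (@countable0 U); exists x.
move=> x n [Ex bx].
have uf : ~ countable (fibre n (c n x)).
  by move=> cf; apply: bx; exists n => //; exists (c n x).
have [x' [[[Ex' cx'] bx'] xx']] := not_sub _ _ (uE' _ uf) (countable1 x).
by exists x'; split.
Qed.

Lemma floor_eq_close (R : realType) (n : nat) (x y : R) :
  Num.floor (x * n.+1%:R) = Num.floor (y * n.+1%:R) -> `|x - y| < n.+1%:R^-1.
Proof.
move=> xy; have n0 : 0 < n.+1%:R :> R by [].
rewrite -[ltRHS]mul1r ltr_pdivlMr// -[X in _ * X](gtr0_norm n0) -normrM mulrBl.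
have := floor_itv (x * n.+1%:R); have := floor_itv (y * n.+1%:R).
rewrite xy ltr_norml !intrD => /andP[? ?] /andP[? ?]; apply/andP; split; lra.
Qed.

(** Fusion of condensation points, the pieces of [uncountable_condensation] being
    the intervals of length 1/(n+1). *)
Lemma closed_uncountable_cantor (R : realType) (Y : set R) :
  closed Y -> ~ countable Y ->
  exists2 psi, cantor_embedding psi & forall t, Y (psi t).
Proof.
move=> cY uY.
have [E [EY [y Ey]] Econd] :=
  uncountable_condensation (fun n x => Num.floor (x * n.+1%:R) : int) uY.
have [||||psi [X [r [psiE _ XE rE psiX]]]] := @fusion R
  (fun X => forall x, x \in X -> E x) (fun _ _ _ => True) y 1.
- by [].
- by move=> z; rewrite inE => /eqP->.
- move=> X x e XE xX /exists_natSinv_lt[n ne].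
  have [x' [x'x Ex' /floor_eq_close xx']] := Econd x n (XE _ xX).
  exists x'; split; [exact/eqP|exact: lt_trans ne|].
  by move=> z; rewrite inE => /orP[/eqP->|/XE].
- by move=> k X _; exists 1.
exists psi => // t; rewrite (iffLR (closure_id _) cY) => V /nbhs_ballP[e /= e0 eV].
have [k ke] := exists_natSinv_lt e0; have [x xX psix] := psiX t k.
have [XE' _ _] := XE k; exists x; split; first exact/EY/XE'.
apply: eV; rewrite /ball /=; apply: le_lt_trans psix _.
by have /andP[_ rk] := rE k; exact: lt_trans ke.
Qed.

(** * Cantor sets of sections with a large common part *)

(** Only countably many unions are involved, so sections that are coded by the
    same list L differ by measure at most e.  This is the separability used
    below. *)
Lemma compact_rational_cover (R : realType) (C : set R) (e : R) :
  compact C -> 0 < e -> exists L : seq nat,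
    C `<=` cover [set n | n \in L] (@rational_ball R) /\
    (lebesgue_measure (cover [set n | n \in L] (@rational_ball R) `\` C) < e%:E)%E.
Proof.
move=> cC e0; have mC : measurable C.
  apply: measurable_realfun.closed_measurable.
  by apply: compact_closed => //; exact: Rhausdorff.
have [U [oU CU Ue]] :=
  lebesgue_regularity_outer mC (compact_finite_measure cC) e0.
pose D := [set n | @rational_ball R n `<=` U].
have : cover_compact C by rewrite -compact_cover.
move=> /(_ _ D (@rational_ball R)) [].
- by move=> n _; exact: rational_ball_open.
- move=> x /CU Ux.
  have [n [xn nU]] := rational_ball_basis (open_nbhs_nbhs (conj oU Ux)).
  by exists n.
move=> L LD CL; exists (finmap.enum_fset L); split => //.
apply: le_lt_trans Ue; apply: le_measure; rewrite ?inE.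
- apply: measurableD => //; apply: measurable_realfun.open_measurable.
  by apply: bigcup_open => n _; exact: rational_ball_open.
- by apply: measurableD => //; exact: measurable_realfun.open_measurable.
- move=> x [[n nL nx] Cx]; split => //.
  by have := LD _ nL; rewrite inE; apply.
Qed.

Lemma closed_section1 (R : realType) (K : set (R * R)) (x : R) :
  closed K -> closed [set y | K (x, y)].
Proof.
move=> cK; rewrite -openC; apply: (@open_section1 _ (~` K)).
exact: closed_openC.
Qed.

Definition common_fiber (R : realType) (K : set (R * R)) (X : seq R) :=
  \bigcap_(x in [set x | x \in X]) [set y | K (x, y)].

Lemma common_fiber_cons (R : realType) (K : set (R * R)) x (X : seq R) :
  common_fiber K (x :: X) = common_fiber K X `&` [set y | K (x, y)].
Proof.
apply/seteqP; split => [y Ky|y [KX Kx] z /=].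
  split; last by apply: (Ky x); rewrite /= mem_head.
  by move=> z zX; apply: (Ky z); rewrite /= inE zX orbT.
by rewrite inE => /orP[/eqP->//|/KX].
Qed.

Lemma closed_common_fiber (R : realType) (K : set (R * R)) (X : seq R) :
  closed K -> closed (common_fiber K X).
Proof. by move=> cK; apply: closed_bigI => x _; exact: closed_section1. Qed.

Lemma bounded_fiber_compact (R : realType) (K : set (R * R)) (N : R) (x : R) :
  closed K -> (forall p, K p -> `|p.2| <= N) -> compact [set y | K (x, y)].
Proof.
move=> cK KN; apply: (subclosed_compact _ (@segment_compact R (- N) N)).
  exact: closed_section1.
by move=> y /KN; rewrite /= in_itv/= ler_norml.
Qed.

Lemma closed_near (R : realType) (K : set (R * R)) (x y : R) :
  closed K -> (forall e, 0 < e -> exists2 z, `|x - z| < e & K (z, y)) ->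
  K (x, y).
Proof.
move=> cK Kz; rewrite (iffLR (closure_id _) cK) => V /nbhs_ballP[e /= e0 eV].
have [z xz Kzy] := Kz _ e0; exists (z, y); split => //.
by apply: eV; split => //=; exact: ballxx.
Qed.

(** The pieces of the n-th partition consist of the x with the same floor of
    (n+1) x and the same union of rational balls containing K_x with excess less
    than 1/(n+1).  If x and x' are in the same piece, then K_x minus K_x' has
    measure less than 1/(n+1); adding x' to a finite set X that contains x
    therefore lowers the measure of the common fiber by less than 1/(n+1), and
    the strict bound c survives for n large.  As X k increases with k, the common
    fibers decrease and their intersection Y has measure at least c; since K is
    closed, a point of Y belongs to K_z for every limit z of points of the X k. *)
Lemma cantor_common_fiber (R : realType) (K : set (R * R)) (N c : R) :
  closed K -> (forall p, K p -> `|p.2| <= N) ->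
  ~ countable [set x | (c%:E < lebesgue_measure [set y | K (x, y)])%E] ->
  exists phi Y, [/\ cantor_embedding phi, closed Y,
    (c%:E <= lebesgue_measure (Y : set R))%E &
    forall s y, Y y -> K (phi s, y)].
Proof.
move=> cK KN uE; have cfib x := @bounded_fiber_compact R K N x cK KN.
have mfib X : measurable (common_fiber K X : set R).
  by apply: measurable_realfun.closed_measurable; exact: closed_common_fiber.
have mK x : measurable ([set y | K (x, y)] : set R).
  by apply: measurable_realfun.closed_measurable; exact: closed_section1.
have ffib X x : x \in X -> lebesgue_measure (common_fiber K X) \is a fin_num.
  move=> xX; rewrite ge0_fin_numE ?measure_ge0//.
  apply: le_lt_trans (compact_finite_measure (cfib x)).
  apply: le_measure; rewrite ?inE; [exact: mfib|exact: mK|].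
  by move=> y; exact.
have inv0 k : 0 < k.+1%:R^-1 :> R by rewrite invr_gt0.
have /choice[L LE] : forall p : nat * R, exists L : seq nat,
    [set y | K (p.2, y)] `<=` cover [set n | n \in L] (@rational_ball R) /\
    (lebesgue_measure (cover [set n | n \in L] (@rational_ball R) `\`
      [set y | K (p.2, y)]) < (p.1.+1%:R^-1)%:E)%E.
  by move=> [n x]; exact: compact_rational_cover.
have [E [Ec [x0 Ex0]] Econd] := uncountable_condensation
  (fun n x => (L (n, x), Num.floor (x * n.+1%:R) : int)) uE.
pose F (X : seq R) := (forall x, x \in X -> E x) /\
  (c%:E < lebesgue_measure (common_fiber K X))%E.
have [||||phi [X [r [phiE _ XE rE phiX]]]] := @fusion R
  F (fun _ _ _ => True) x0 1.
- by [].
- split; first by move=> z; rewrite inE => /eqP->.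
  rewrite common_fiber_cons /common_fiber; apply: lt_le_trans (Ec _ Ex0) _.
  apply: le_measure; rewrite ?inE; [exact: mK|exact: measurableI (mfib _) (mK _)|].
  by move=> y Ky; split.
- move=> X x e [XE cX] xX e0.
  have fX := ffib _ _ xX; rewrite -(fineK fX) lte_fin in cX.
  set a := fine _ in cX.
  have [|n] := @exists_natSinv_lt R (Num.min e (a - c)).
    by rewrite lt_min e0 subr_gt0.
  rewrite lt_min => /andP[ne nac].
  have [x' [x'x Ex' [LL /floor_eq_close xx']]] := Econd x n (XE _ xX).
  exists x'; split; [exact/eqP|exact: lt_trans ne|split].
    by move=> z; rewrite inE => /orP[/eqP->|/XE].
  have fX' := ffib (x' :: X) x' (mem_head _ _).
  have : (lebesgue_measure (common_fiber K X) <=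
     lebesgue_measure (common_fiber K (x' :: X)) + (n.+1%:R^-1)%:E)%E.
    rewrite -(setUIDK (common_fiber K X) [set y | K (x', y)]).
    apply: le_trans (measureU2 _ _ _) _.
    + exact: measurableI (mfib _) (mK _).
    + exact: measurableD (mfib _) (mK _).
    rewrite common_fiber_cons leeD2l//; have [_ /ltW] := LE (n, x').
    apply: le_trans; apply: le_measure; rewrite ?inE.
    + exact: measurableD (mfib _) (mK _).
    + apply: measurableD (mK _); apply: measurable_realfun.open_measurable.
      by apply: bigcup_open => m _; exact: rational_ball_open.
    + move=> y [Xy x'y]; split => //; rewrite LL.
      by apply: (LE (n, x)).1; exact: Xy.
  rewrite -(fineK fX) -(fineK fX') -EFinD lee_fin lte_fin -/a.
  by move: nac; move: (n.+1%:R^-1) (fine _) => d b; lra.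
- by move=> k X _; exists 1.
exists phi, (\bigcap_k common_fiber K (X k)); split => //.
- by apply: closed_bigI => k _; exact: closed_common_fiber.
- have mono : {homo (fun k => common_fiber K (X k)) :
      m n / (m <= n)%N >-> (n <= m)%O}.
    apply/nonincreasing_seqP => k; apply/subsetPset => y Xy x xX; apply: Xy.
    by have [_ + _] := XE k; exact.
  have [x xX _] := phiX (fun=> false) 0%N.
  have cv : lebesgue_measure (common_fiber K (X k)) @[k --> \oo] -->
      lebesgue_measure (\bigcap_k common_fiber K (X k)).
    apply: nonincreasing_cvg_mu => //.
    + by rewrite -ge0_fin_numE ?measure_ge0//; exact: ffib xX.
    + by move=> k; exact: mfib.
    + by apply: bigcapT_measurable => k; exact: mfib.
  rewrite -(cvg_lim (@ereal_hausdorff R) cv); apply: lime_ge.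
    exact: cvgP cv.
  by apply: nearW => k; have [[_ /ltW]] := XE k.
move=> s y Yy; apply: closed_near cK _ => e /exists_natSinv_lt[k ke].
have [x xX phix] := phiX s k; exists x; last exact: (Yy k I).
by apply: le_lt_trans phix _; have /andP[_ rk] := rE k; exact: lt_trans ke.
Qed.

(** * Products of Cantor sets in sets of positive measure *)

Lemma open_measurable2 (R : realType) (G : set (R * R)) :
  open G -> measurable (G : set (measurableTypeR R * measurableTypeR R)).
Proof.
move=> oG.
have -> : G = \bigcup_n
    \bigcup_(m in [set m | rational_ball n `*` rational_ball m `<=` G])
    (rational_ball n `*` rational_ball m).
  apply/seteqP; split => [[x y] Gxy|p [n _ [m /= nmG]]]; last exact: nmG.
  have [e e0 eG] := open_plane_box oG Gxy.
  have [n [nx ne]] := rational_ball_basis (nbhsx_ballx x e e0).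
  have [m [my me]] := rational_ball_basis (nbhsx_ballx y e e0).
  exists n => //; exists m => // -[a b] [/= /ne ax /me yb].
  by apply: eG; rewrite distrC.
apply: bigcup_measurable => n _; apply: bigcup_measurable => m _.
by apply: measurableX; apply: measurable_realfun.open_measurable;
  exact: rational_ball_open.
Qed.

Lemma closed_measurable2 (R : realType) (K : set (R * R)) :
  closed K -> measurable (K : set (measurableTypeR R * measurableTypeR R)).
Proof.
by move=> /closed_openC/open_measurable2/measurableC; rewrite setCK.
Qed.

(** Otherwise only countably many sections have positive measure, and the
    integral that defines the product measure vanishes. *)
Lemma positive_uncountable_sections (R : realType) (K : set (R * R)) :
  closed K -> (0 < @borel_lebesgue2 R K)%E ->
  exists2 c : R, 0 < c &
    ~ countable [set x | (c%:E < lebesgue_measure [set y | K (x, y)])%E].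
Proof.
move=> cK; apply: contraPP => /forall2NP cE; apply/negP; rewrite -leNgt.
have mK := closed_measurable2 cK.
have inv0 k : 0 < k.+1%:R^-1 :> R by rewrite invr_gt0.
have sK x : xsection K x = [set y | K (x, y)].
  by apply/seteqP; split => y; rewrite /xsection/= inE.
rewrite /borel_lebesgue2 /= /product_measure1.
pose P := \bigcup_n [set x : R | ((n.+1%:R^-1)%:E <
   lebesgue_measure [set y | K (x, y)])%E].
have cP : countable P.
  apply: bigcup_countable => // n _.
  by apply: contrapT => uE; have [/(_ (inv0 n))|/(_ uE)] := cE n.+1%:R^-1.
rewrite (@ge0_ae_eq_integral _ _ _ _ _ _ (cst 0%E)) ?integral0 //.
- exact: measurable_fun_xsection.
- exists P; split; last 1 first.
  + move=> x /= gx; apply: contrapT => Px; apply: gx => _ /=.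
    apply/eqP; rewrite eq_le measure_ge0 andbT leNgt sK; apply/negP.
    move gE : (lebesgue_measure _) => g; case: g gE => [g| |] // gE g0; apply: Px.
      rewrite lte_fin in g0; have [n ng] := exists_natSinv_lt g0.
      by exists n => //=; rewrite gE lte_fin.
    by exists 0%N => //=; rewrite gE ltry.
  + by apply: countable_measurable => // x; exact: measurable_set1.
  + exact: countable_lebesgue_measure0.
Qed.

Lemma positive_cantor_product (R : realType) (K : set (R * R)) (N : R) :
  closed K -> (forall p, K p -> `|p.2| <= N) -> (0 < @borel_lebesgue2 R K)%E ->
  exists phi psi : (nat -> bool) -> R,
    [/\ cantor_embedding phi, cantor_embedding psi &
        forall s t, K (phi s, psi t)].
Proof.
move=> cK KN /(positive_uncountable_sections cK)[c c0 uE].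
have [phi [Y [phiE cY Yc KY]]] := cantor_common_fiber cK KN uE.
have [|psi psiE Ypsi] := closed_uncountable_cantor cY.
  move=> /countable_lebesgue_measure0 Y0.
  by move: Yc; rewrite Y0 lee_fin leNgt c0.
by exists phi, psi; split => // s t; exact: KY.
Qed.

(** * Regularity of Borel measures on the plane *)

(** Inner regularity of A and of its complement at once, measured inside D; this
    symmetric form makes the stability under complements immediate. *)
Definition closed_approximable (R : realType)
    (mu : {measure set (measurableTypeR R * measurableTypeR R) -> \bar R})
    (D A : set (R * R)) :=
  forall e : R, 0 < e -> exists F G : set (R * R),
    [/\ closed F, closed G, F `<=` A, G `<=` ~` A &
        (mu (D `\` (F `|` G)) < e%:E)%E].

Lemma closed_approximableC (R : realType)
    (mu : {measure set (measurableTypeR R * measurableTypeR R) -> \bar R})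
    (D A : set (R * R)) :
  closed_approximable mu D A -> closed_approximable mu D (~` A).
Proof.
move=> DA e /DA[F [G [cF cG FA GA FGe]]]; exists G, F.
by split; rewrite ?setCK// setUC.
Qed.

(** A union of closed sets need not be closed; since D has finite measure,
    finitely many of them suffice up to a small error. *)
Lemma closed_exhaustion (R : realType)
    (mu : {measure set (measurableTypeR R * measurableTypeR R) -> \bar R})
    (D G0 : set (R * R)) (F : (set (R * R))^nat) (e : R) :
  measurable (D : set (measurableTypeR R * measurableTypeR R)) ->
  (mu D < +oo)%E -> (forall n, closed (F n)) -> closed G0 ->
  (mu (D `\` (\bigcup_n F n `|` G0)) < e%:E)%E ->
  exists m, (mu (D `\` (\bigcup_(n in `I_m) F n `|` G0)) < e%:E)%E.
Proof.
move=> mD muD cF cG0 De; apply: contrapT => /forallNP no_m.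
have cFm m : closed (\bigcup_(n in `I_m) F n `|` G0).
  by apply: closedU => //; apply: closed_bigcup => //; exact: finite_II.
have mH m : measurable ((D `\` (\bigcup_(n in `I_m) F n `|` G0)) :
    set (measurableTypeR R * measurableTypeR R)).
  by apply: measurableD => //; exact: closed_measurable2.
have HE : \bigcap_m (D `\` (\bigcup_(n in `I_m) F n `|` G0)) =
    D `\` (\bigcup_n F n `|` G0).
  apply/seteqP; split => [p Hp|p [Dp FGp] m _].
    split; first by have [] := Hp 0%N I.
    move=> [[n _ Fp]|Gp]; last by have [_ []] := Hp 0%N I; right.
    by have [_ []] := Hp n.+1 I; left; exists n => /=.
  by split => // -[[n _ Fp]|Gp]; apply: FGp; [left; exists n|right].
have cv : mu (D `\` (\bigcup_(n in `I_m) F n `|` G0)) @[m --> \oo] -->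
    mu (D `\` (\bigcup_n F n `|` G0)).
  rewrite -HE; apply: nonincreasing_cvg_mu => //.
  - apply: le_lt_trans muD; apply: le_measure; rewrite ?inE//; exact: subDsetl.
  - exact: bigcapT_measurable.
  - move=> m n mn; apply/subsetPset => p [Dp nFG]; split => // -[[i im Fp]|Gp].
      by apply: nFG; left; exists i => //=; exact: leq_trans mn.
    by apply: nFG; right.
move: De; rewrite ltNge => /negP; apply.
rewrite -(cvg_lim (@ereal_hausdorff R) cv); apply: lime_ge; first exact: cvgP cv.
by apply: nearW => m; rewrite leNgt; apply/negP/no_m.
Qed.

(** With the errors e/2/2^(n+1) at stage n, the union of the inner sets and the
    intersection of the closed sets disjoint from the A n leave an error of at
    most e/2; then [closed_exhaustion] replaces the union by a finite one. *)
Lemma closed_approximable_bigcup (R : realType)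
    (mu : {measure set (measurableTypeR R * measurableTypeR R) -> \bar R})
    (D : set (R * R)) (A : (set (R * R))^nat) :
  measurable (D : set (measurableTypeR R * measurableTypeR R)) ->
  (mu D < +oo)%E -> (forall n, closed_approximable mu D (A n)) ->
  closed_approximable mu D (\bigcup_n A n).
Proof.
move=> mD muD DA e e0.
have e2 : 0 < e / 2 by rewrite divr_gt0.
have /choice[F] : forall n, exists FG : set (R * R) * set (R * R),
    [/\ closed FG.1, closed FG.2, FG.1 `<=` A n, FG.2 `<=` ~` A n &
        (mu (D `\` (FG.1 `|` FG.2)) < (e / 2 / (2 ^ n.+1)%:R)%:E)%E].
  move=> n; have [|F [G [? ? ? ? ?]]] := DA n (e / 2 / (2 ^ n.+1)%:R).
    by rewrite divr_gt0// ltr0n expn_gt0.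
  by exists (F, G).
move=> /all_and5[cF cG FA GA FGe].
pose G0 := \bigcap_n (F n).2.
have cG0 : closed G0 by apply: closed_bigI => n _; exact: cG.
have mDD n : measurable ((D `\` ((F n).1 `|` (F n).2)) :
    set (measurableTypeR R * measurableTypeR R)).
  apply: measurableD => //; apply: closed_measurable2.
  by apply: closedU; [exact: cF|exact: cG].
have [|m me] := @closed_exhaustion R mu D G0 (fun n => (F n).1) e mD muD cF cG0.
  apply: (@le_lt_trans _ _ (e / 2)%:E); last by rewrite lte_fin; lra.
  apply: le_trans (epsilon_trick0 xpredT (ltW e2)).
  apply: le_trans (_ : _ <= \sum_(n <oo) mu (D `\` ((F n).1 `|` (F n).2)))%E _.
    apply: measure_sigma_subadditive => //.
      apply: measurableD => //; apply: measurableU; last exact: closed_measurable2.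
      by apply: bigcupT_measurable => n; exact: closed_measurable2.
    move=> p [Dp nFG]; apply: contrapT => nUp; apply: nFG.
    have [Fp|nFp] := pselect ((\bigcup_n (F n).1) p); [by left|right].
    move=> n _; apply: contrapT => nGp; apply: nUp; exists n => //; split => //.
    by move=> [Fp|//]; apply: nFp; exists n.
  by apply: lee_nneseries => // n _; exact: ltW.
exists (\bigcup_(n in `I_m) (F n).1), G0; split => //.
- by apply: closed_bigcup => //; exact: finite_II.
- by move=> p [n _ /FA Ap]; exists n.
- by move=> p Gp [n _ Ap]; exact: (GA n p (Gp n I)).
Qed.

Lemma closed_approximable_Fsigma (R : realType)
    (mu : {measure set (measurableTypeR R * measurableTypeR R) -> \bar R})
    (D A : set (R * R)) (G : (set (R * R))^nat) :
  measurable (D : set (measurableTypeR R * measurableTypeR R)) ->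
  (mu D < +oo)%E -> closed A -> (forall n, closed (G n)) ->
  ~` A = \bigcup_n G n -> closed_approximable mu D A.
Proof.
move=> mD muD cA cG AG e e0.
have [|m me] := closed_exhaustion (e := e) mD muD cG cA.
  by rewrite -AG setUC setUv setDT measure0.
exists A, (\bigcup_(n in `I_m) G n); split => //.
- by apply: closed_bigcup => //; exact: finite_II.
- by rewrite AG => p [n _ Gp]; exists n.
- by rewrite setUC.
Qed.

(** The good sets A form a sigma-algebra, and it contains the closed half-lines,
    whose complements are countable unions of closed half-lines. *)
Lemma closed_approximable_strip (R : realType)
    (mu : {measure set (measurableTypeR R * measurableTypeR R) -> \bar R})
    (D : set (R * R)) (h : R * R -> R) (A : set R) :
  measurable (D : set (measurableTypeR R * measurableTypeR R)) ->
  (mu D < +oo)%E -> continuous h -> measurable A ->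
  closed_approximable mu D (h @^-1` A).
Proof.
move=> mD muD ch mA.
have {}mA : (@measurable_realfun.RGenCInfty.G R).-sigma.-measurable A.
  by rewrite -measurable_realfun.RGenCInfty.measurableE.
have {mA} : <<s @measurable_realfun.RGenCInfty.G R >> A := mA.
move: A; apply: smallest_sub.
  split.
  - rewrite preimage_set0 => e e0; exists set0, setT.
    by split; [exact: closed0|exact: closedT|by []|by move=> ? _|
      rewrite set0U setDT measure0].
  - by move=> A hA; rewrite setTD preimage_setC; exact: closed_approximableC.
  - by move=> A hA; rewrite preimage_bigcup; exact: closed_approximable_bigcup.
move=> _ [x ->].
apply: (@closed_approximable_Fsigma _ _ _ _
   (fun n => h @^-1` [set` `]-oo, x - n.+1%:R^-1]%R])) => //.
- by apply: closed_comp => [p _|]; [exact: ch|exact: interval_closed].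
- by move=> n; apply: closed_comp => [p _|]; [exact: ch|exact: interval_closed].
have inv0 k : 0 < k.+1%:R^-1 :> R by rewrite invr_gt0.
apply/seteqP; split => [p /=|p [n _] /=].
  rewrite in_itv/= andbT => /negP; rewrite -ltNge => /ltr_add_invr[n hx].
  by exists n => //=; rewrite in_itv/= lerBrDr ltW.
rewrite !in_itv/= andbT => hx; apply/negP; rewrite -ltNge.
by apply: le_lt_trans hx _; rewrite ltrBlDr ltrDl.
Qed.

Lemma borel_closed_approximable (R : realType)
    (mu : {measure set (measurableTypeR R * measurableTypeR R) -> \bar R})
    (D A : set (measurableTypeR R * measurableTypeR R)) :
  measurable D -> (mu D < +oo)%E -> measurable A ->
  closed_approximable mu D A.
Proof.
move=> mD muD; rewrite measurable_prod_measurableType; move: A.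
have UC := closed_approximable_bigcup mD muD.
apply: smallest_sub.
  split.
  - rewrite -(@preimage_set0 _ _ (@fst R R)).
    apply: closed_approximable_strip => //; by move=> p; exact: cvg_fst.
  - by move=> A hA; rewrite setTD; exact: closed_approximableC.
  - by move=> A hA; exact: UC.
move=> _ [A mA [B mB <-]].
have -> : A `*` B = ~` (\bigcup_n (if n is 0%N then ~` ((@fst R R) @^-1` A)
                                   else ~` ((@snd R R) @^-1` B))).
  apply/seteqP; split => [[x y] [/= Ax By] [[|n] _]|[x y] nU]; [exact|exact|].
  split => /=; apply: contrapT => h; apply: nU; [by exists 0%N|by exists 1%N].
apply: closed_approximableC; apply: UC => -[|n]; apply: closed_approximableC;
  apply: closed_approximable_strip => // p; [exact: cvg_fst|exact: cvg_snd].
Qed.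

(** * Lusin theorem for the plane *)

(** The completed measure is this outer measure, so that Borel and Lebesgue
    measurable sets can be compared without changing the measure. *)
Definition outer2 (R : realType) : 
  {outer_measure set (measurableTypeR R * measurableTypeR R) -> \bar R} :=
  ((@borel_lebesgue2 R)^*)%mu.

Definition square (R : realType) (N : nat) : set (R * R) :=
  [set p | `|p.1| <= N%:R /\ `|p.2| <= N%:R].

Lemma squareE (R : realType) N :
  @square R N = [set` `[- N%:R, N%:R]%R] `*` [set` `[- N%:R, N%:R]%R].
Proof. by apply/seteqP; split => p; rewrite /square /= !in_itv/= !ler_norml. Qed.

Lemma closed_square (R : realType) N : closed (@square R N).
Proof.
rewrite squareE.
have -> : forall A B : set R, A `*` B = fst @^-1` A `&` snd @^-1` B by [].
apply: closedI; (apply: closed_comp => [p _|]; last exact: interval_closed).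
  exact: cvg_fst.
exact: cvg_snd.
Qed.

Lemma borel_lebesgue2_square (R : realType) N :
  (@borel_lebesgue2 R (@square R N) < +oo)%E.
Proof.
rewrite squareE /borel_lebesgue2 /= product_measure1E//.
rewrite lte_mul_pinfty// ?ge0_fin_numE//;
  exact: compact_finite_measure (@segment_compact R _ _).
Qed.

Lemma outer2_borel (R : realType) (A : set (R * R)) :
  measurable (A : set (measurableTypeR R * measurableTypeR R)) ->
  outer2 R A = @borel_lebesgue2 R A.
Proof. exact: measurable_mu_extE. Qed.

Lemma borel_lplane (R : realType) (A : set (R * R)) :
  measurable (A : set (measurableTypeR R * measurableTypeR R)) ->
  measurable (A : set (lplane R)).
Proof. by move=> mA; apply: sub_caratheodory; exact: sub_sigma_algebra. Qed.

Lemma le_outer2 (R : realType) (A B : set (R * R)) :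
  A `<=` B -> (outer2 R A <= outer2 R B)%E.
Proof. by move=> AB; apply: le_outer_measure. Qed.

Lemma outer2_hull (R : realType) (A : set (R * R)) (e : R) :
  (outer2 R A < +oo)%E -> 0 < e ->
  exists B : set (measurableTypeR R * measurableTypeR R),
    [/\ measurable B, A `<=` B & (borel_lebesgue2 B < outer2 R A + e%:E)%E].
Proof.
move=> Afin e0; have fA : outer2 R A \is a fin_num.
  by rewrite ge0_fin_numE//; exact: outer_measure_ge0.
have [_ [F [mF AF] <-] Fe] := lb_ereal_inf_adherent e0 fA.
exists (\bigcup_n F n); split => //; first exact: bigcupT_measurable.
apply: le_lt_trans Fe; apply: measure_sigma_subadditive => //.
exact: bigcupT_measurable.
Qed.

(** Enclose the part of the square outside A in a Borel set B of nearly the same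
    outer measure.  By Caratheodory's criterion B exceeds that part by little, so
    the Borel set formed by the square minus B is contained in A and nearly fills
    it; it remains to approximate it by a closed set. *)
Lemma lplane_inner_regular (R : realType) (A : set (lplane R)) N (e : R) :
  measurable A -> 0 < e ->
  exists F : set (R * R), [/\ closed F, F `<=` A &
    (outer2 R (A `&` @square R N `\` F) < e%:E)%E].
Proof.
move=> mA e0; have e2 : 0 < e / 2 by rewrite divr_gt0.
pose D := @square R N.
have mD : measurable (D : set (measurableTypeR R * measurableTypeR R)).
  exact: closed_measurable2 (@closed_square R N).
have Dfin : (borel_lebesgue2 D < +oo)%E := borel_lebesgue2_square R N.
pose DA : set (lplane R) := D `\` A.
have mDA : measurable DA by apply: measurableD => //; exact: borel_lplane.
have DAfin : (outer2 R DA < +oo)%E.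
  apply: le_lt_trans Dfin; rewrite -(outer2_borel mD).
  by apply: le_outer2; exact: subDsetl.
have [B [mB DAB Be]] := outer2_hull DAfin e2.
have Brest : (outer2 R (B `\` DA) < (e / 2)%:E)%E.
  have BE : outer2 R B = (outer2 R (B `&` DA) + outer2 R (B `&` ~` DA))%E := mDA B.
  rewrite (outer2_borel mB) (setIidr DAB) in BE.
  have fDA : outer2 R DA \is a fin_num.
    by rewrite ge0_fin_numE//; exact: outer_measure_ge0.
  by rewrite BE lteD2lE// in Be.
have [F [G [cF cG FDB GDB FGe]]] :=
  borel_closed_approximable mD Dfin (measurableD mD mB) e2.
exists F; split => //.
  by move=> p /FDB[Dp nBp]; apply: contrapT => nAp; apply: nBp; exact: DAB.
apply: le_lt_trans (_ : _ <= outer2 R ((B `\` DA) `|` (D `\` (F `|` G))))%E _.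
  apply: le_outer2 => p [[Ap Dp] nFp].
  have [Bp|nBp] := pselect (B p); first by left; split => // -[].
  right; split => // -[//|/GDB]; exact.
apply: le_lt_trans (outer_measureU2 _ _ _) _.
rewrite [e](_ : _ = e / 2 + e / 2); last by rewrite -splitr.
rewrite EFinD; apply: lteD => //.
rewrite [X in (X < _)%E]outer2_borel//; apply: measurableD => //.
by apply: closed_measurable2; exact: closedU.
Qed.

(** For each rational ball V choose closed sets inside the preimage of V and
    inside its complement that together miss little of a square.  On the
    intersection K of all these unions with a closed part of B in the square, the
    preimage of V is relatively open, its
    complement being the trace of a closed set.  The errors are summable to less
    than the measure of B in the square. *)
Lemma lplane_lusin (R : realType) (f : R * R -> R) (B : set (lplane R)) :
  measurable_fun [set: lplane R] (f : lplane R -> R) ->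
  measurable B -> (0 < lebesgue2 B)%E ->
  exists (K : set (R * R)) (N : R),
    [/\ closed K, K `<=` B, forall p, K p -> `|p.2| <= N,
        (0 < @borel_lebesgue2 R K)%E & {within K, continuous f}].
Proof.
move=> mf mB B0; rewrite -[lebesgue2 B]/(outer2 R B) in B0.
have [N BN] : exists N, (0 < outer2 R (B `&` @square R N))%E.
  apply: contrapT => /forallNP no_N; move: B0; rewrite ltNge => /negP; apply.
  apply: le_trans (_ : _ <= outer2 R (\bigcup_N (B `&` @square R N)))%E _.
    apply: le_outer2 => p Bp.
    pose n := Num.truncn (Num.max `|p.1| `|p.2|).
    have := truncnS_gt (Num.max `|p.1| `|p.2|).
    rewrite gt_max => /andP[/ltW p1 /ltW p2].
    by exists n.+1.
  apply: le_trans (outer_measure_sigma_subadditive _ _) _.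
  rewrite eseries0// => n _ _; apply/eqP; rewrite eq_le.
  by rewrite outer_measure_ge0 andbT leNgt; apply/negP/no_N.
pose D := @square R N.
have [c c0 cB] : exists2 c : R, 0 < c & (c%:E < outer2 R (B `&` D))%E.
  case: (outer2 R _) BN => [b| |]//; last by exists 1; rewrite ?ltry.
  by rewrite lte_fin => b0; exists (b / 2); rewrite ?divr_gt0// lte_fin; lra.
have mfV n : measurable (f @^-1` rational_ball n : set (lplane R)).
  rewrite -[X in measurable X]setTI; apply: mf; first exact: measurableT.
  by apply: measurable_realfun.open_measurable; exact: rational_ball_open.
pose err n := c / 2 / (2 ^ n.+1)%:R.
have err0 n : 0 < err n by rewrite !divr_gt0// ltr0n expn_gt0.
have [F [cF FB Fe]] := lplane_inner_regular N mB (err0 0%N).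
have /choice[G GE] : forall n, exists G : set (R * R) * set (R * R),
    [/\ closed G.1, closed G.2, G.1 `<=` f @^-1` rational_ball n,
        G.2 `<=` ~` (f @^-1` rational_ball n) &
        (outer2 R (D `\` (G.1 `|` G.2)) <= (err n.+1)%:E)%E].
  move=> n; have e2 : 0 < err n.+1 / 2 by rewrite divr_gt0.
  have [G [cG GV Ge]] := lplane_inner_regular N (mfV n) e2.
  have [H [cH HV He]] := lplane_inner_regular N (measurableC (mfV n)) e2.
  exists (G, H); split => //=.
  apply: le_trans (_ : _ <= outer2 R ((f @^-1` rational_ball n `&` D `\` G) `|`
    (~` (f @^-1` rational_ball n) `&` D `\` H)))%E _.
    apply: le_outer2 => p [Dp GHp].
    have [Vp|Vp] := pselect ((f @^-1` rational_ball n) p); [left|right].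
      by split => // Gp; apply: GHp; left.
    by split => // Hp; apply: GHp; right.
  apply: le_trans (outer_measureU2 _ _ _) _.
  rewrite [err _](_ : _ = err n.+1 / 2 + err n.+1 / 2); last by rewrite -splitr.
  by rewrite EFinD; apply: leeD; exact: ltW.
have {GE}/all_and5[cG cH GV HV GHe] := GE.
pose K := F `&` D `&` \bigcap_n ((G n).1 `|` (G n).2).
have cK : closed K.
  apply: closedI; first by apply: closedI => //; exact: closed_square.
  by apply: closed_bigI => n _; apply: closedU; [exact: cG|exact: cH].
exists K, N%:R; split => //.
- by move=> p [[/FB]].
- by move=> p [[_ []]].
- rewrite -(outer2_borel (closed_measurable2 cK)).
  pose Err n := if n is m.+1 then D `\` ((G m).1 `|` (G m).2) else B `&` D `\` F.
  have BE : (outer2 R (B `&` D) <= outer2 R K + (c / 2)%:E)%E.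
    apply: le_trans (_ : _ <= outer2 R (K `|` \bigcup_n Err n))%E _.
      apply: le_outer2 => p [Bp Dp].
      have [Ep|nEp] := pselect ((\bigcup_n Err n) p); [by right|left].
      split.
        split => //; apply: contrapT => nFp; apply: nEp; exists 0%N => //.
      by move=> n _; apply: contrapT => nGp; apply: nEp; exists n.+1.
    apply: le_trans (outer_measureU2 _ _ _) _; rewrite leeD2l//.
    apply: le_trans (outer_measure_sigma_subadditive _ _) _.
    have c2 : 0 <= c / 2 by rewrite ltW// divr_gt0.
    apply: le_trans (epsilon_trick0 xpredT c2).
    apply: lee_nneseries => [n _ _|n _]; first exact: outer_measure_ge0.
    by case: n => [|n]; [exact: ltW|exact: GHe].
  rewrite ltNge; apply/negP => K0; have := lt_le_trans cB BE.
  rewrite ltNge => /negP; apply; apply: le_trans (leeD2r _ K0) _.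
  by rewrite add0e lee_fin; lra.
apply/subspace_continuousP => p Kp V /rational_ball_basis[n [nfp nV]].
rewrite /= /nbhs /= /within /=.
have : nbhs p (~` (G n).2).
  apply: open_nbhs_nbhs; split; first exact: closed_openC.
  by move=> /HV; exact.
apply: filterS => q nHq [_ /(_ n I)]/= [Gq|//].
by apply: nV; exact: (GV n).
Qed.

(** * The two cases *)

Lemma baire_contains_perfect_product (R : realType) (f : R * R -> R)
    (C B : set (R * R)) :
  residual C -> {within C, continuous f} ->
  has_baire_property B -> ~ meager B -> contains_perfect_product (FC f `&` B).
Proof.
move=> Cres fC [U oU mBU] nmB.
have U0 : U !=set0.
  apply/set0P/eqP => U0; apply: nmB.
  by move: mBU; rewrite U0 setY0.
have nBUres : residual (~` (B `+` U)) by rewrite /residual setCK.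
have [phi [psi [phiE psiE CU]]] :=
  residual_cantor_product (residualI Cres nBUres) oU U0.
apply: (@contains_perfect_product_FC _ f (C `&` B) B phi psi) => //.
- by apply: continuous_subspaceW fC => p [].
- move=> s t; have [Ust [Cst nBU]] := CU s t; split => //.
  by apply: contrapT => nB; apply: nBU; right.
Qed.

Lemma lebesgue_contains_perfect_product (R : realType) (f : R * R -> R)
    (B : set (lplane R)) :
  measurable_fun [set: lplane R] (f : lplane R -> R) ->
  measurable B -> (0 < lebesgue2 B)%E ->
  contains_perfect_product (FC f `&` B).
Proof.
move=> mf mB B0; have [K [N [cK KB KN K0 fK]]] := lplane_lusin mf mB B0.
have [phi [psi [phiE psiE Kphi]]] := positive_cantor_product cK KN K0.
exact: contains_perfect_product_FC fK KB phiE psiE Kphi.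
Qed.

Theorem theorem5 (R : realType) (f : R * R -> R) :
  (baire_fun f ->
     (forall B : set (R * R), has_baire_property B -> ~ meager B ->
        contains_perfect_product (FC f `&` B)) /\
     residual (FC f)) /\
  (measurable_fun [set: lplane R] (f : lplane R -> R) ->
     (forall B : set (lplane R), measurable B -> (0 < lebesgue2 B)%E ->
        contains_perfect_product (FC f `&` B)) /\
     full_outer_measure (FC f)).
Proof.
split=> [fB|mf].
  have [C Cres fC] := baire_fun_continuous_residual fB; split.
    by move=> B; exact: baire_contains_perfect_product fC.
  exact: FC_residual fC.
split; first by move=> B; exact: lebesgue_contains_perfect_product.
move=> [A [mA AFC A0]].
have [P [Q [_ _ [x Px] [y Qy] PQ]]] := lebesgue_contains_perfect_product mf mA A0.
have [FCxy Axy] := PQ (x, y) (conj Px Qy).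
exact: AFC Axy FCxy.
Qed.
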